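(* Let $k\in\mathbb{N}$, $k>2$, let $\mathcal{O}$ be an oval with support function $h$, let $\mathcal{P}_k$ be its $k$th Order Preserving Set and $D_{\mathcal{O}}$ its Steiner disk. Then \[ L_{\mathcal{O}}^2-4\pi A_{\mathcal{O}}-4\pi|A_{\mathcal{P}_k}|\geqslant \frac{8\pi^2k}{2\pi\cot\left(\frac{\pi}{k}\right)+k}\,d_\infty^2(\mathcal{O},\mathcal{P}_k+D_{\mathcal{O}}), \] where $L_{\mathcal{O}}$ is the length of $\mathcal{O}$ and $A_{\mathcal{O}}$ the area it bounds.
   Context: An oval is a simple, closed, regular, smooth planar curve with nowhere vanishing curvature. Write $u(s)=(\cos s,\sin s)$, $u'(s)=(-\sin s,\cos s)$. The support function of $\mathcal{O}$ is $h(s)=\sup_{x\in\mathcal{O}}\langle x,u(s)\rangle=a_0+\sum_{n\geqslant1}(a_n\cos(ns)+b_n\sin(ns))$, and $\mathcal{O}(s)=h(s)u(s)+h'(s)u'(s)$. The average width is $\overline{w}=\frac1\pi\int_0^{2\pi}h=2a_0$; the Steiner point is $(a_1,b_1)=\frac1\pi\int_0^{2\pi}h(s)u(s)\,ds$. The Steiner disk $D_{\mathcal{O}}$ is the disk centered at the Steiner point of radius $\frac12|\overline{w}|$; its support function is $a_0+a_1\cos s+b_1\sin s$. The $k$th Order Preserving Set $\mathcal{P}_k$ is the curve $\mathcal{P}_k(s)=h_k(s)u(s)+h_k'(s)u'(s)$ with support function $h_k(s)=\frac1k\sum_{j=0}^{k-1}h(s+\tfrac{2\pi j}{k})-\frac12\overline{w}$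 (equivalently $\mathcal{P}_k(s)=\frac{1}{k}\sum_{j=1}^{k}\big(\cos(\tfrac{2\pi j}{k})\mathcal{O}(s+\tfrac{2\pi j}{k})-\sin(\tfrac{2\pi j}{k})\mathcal{O}(s+\tfrac{2\pi j}{k})^{\perp}\big)-\frac12\overline{w}u(s)$ with $(x,y)^\perp=(-y,x)$). Its oriented area is $A_{\mathcal{P}_k}=\frac12\int_0^{2\pi}(h_k^2-h_k'^2)\,ds$. The Minkowski sum $\mathcal{P}_k+D_{\mathcal{O}}$ is the convex body with support function $h_k+a_0+a_1\cos s+b_1\sin s$. For two bodies with support functions $h_1,h_2$, $d_\infty=\max_s|h_1(s)-h_2(s)|$ (Hausdorff distance). *)

(* Defs.v *)
From Stdlib Require Import Reals Lra.
From Coquelicot Require Import Coquelicot.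
Open Scope R_scope.

(* An oval is described by its support function h : R -> R (2pi-periodic,
   smooth) with radius of curvature h + h'' positive everywhere
   (nowhere vanishing curvature, strict convexity). *)
Definition is_oval_support (h : R -> R) : Prop :=
  (forall s, h (s + 2 * PI) = h s) /\
  (forall n s, ex_derive_n h n s) /\
  (forall s, h s + Derive_n h 2 s > 0).

Definition oval_x (h : R -> R) (s : R) : R :=
  h s * cos s - Derive h s * sin s.
Definition oval_y (h : R -> R) (s : R) : R :=
  h s * sin s + Derive h s * cos s.

Definition oval_length (h : R -> R) : R :=
  RInt (fun s => sqrt (Derive (oval_x h) s ^ 2 + Derive (oval_y h) s ^ 2))
       0 (2 * PI).

(* Area enclosed (Green's formula, curve traversed counterclockwise). *)
Definition oval_area (h : R -> R) : R :=
  / 2 * RInt (fun s => oval_x h s * Derive (oval_y h) s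
                       - oval_y h s * Derive (oval_x h) s) 0 (2 * PI).

Definition a0 (h : R -> R) : R := / (2 * PI) * RInt h 0 (2 * PI).
Definition a1 (h : R -> R) : R := / PI * RInt (fun s => h s * cos s) 0 (2 * PI).
Definition b1 (h : R -> R) : R := / PI * RInt (fun s => h s * sin s) 0 (2 * PI).
Definition avg_width (h : R -> R) : R := / PI * RInt h 0 (2 * PI).

(* Support function of the k-th Order Preserving Set. *)
Definition hk (h : R -> R) (k : nat) (s : R) : R :=
  / INR k * sum_f_R0 (fun j => h (s + 2 * PI * INR j / INR k)) (k - 1)
  - / 2 * avg_width h.

Definition area_Pk (h : R -> R) (k : nat) : R :=
  / 2 * RInt (fun s => hk h k s ^ 2 - Derive (hk h k) s ^ 2) 0 (2 * PI).

Definition h_Pk_plus_D (h : R -> R) (k : nat) (s : R) : R :=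
  hk h k s + a0 h + a1 h * cos s + b1 h * sin s.

(* Hausdorff distance between bodies with support functions h1, h2:
   sup_s |h1 s - h2 s|. *)
Definition d_infty (h1 h2 : R -> R) : R :=
  real (Lub_Rbar (fun x => exists s, x = Rabs (h1 s - h2 s))).

(* Main.v *)
(** Subtracting from [h] its mean, its first harmonics and [hk h k] leaves a
    function [f] that is orthogonal to [1], [cos], [sin] and whose sum over each
    orbit of the rotation by [d = 2 PI / k] vanishes; the left hand side equals
    [2 PI] times [Q f], the integral of [f'^2 - f^2], because [hk h k] has
    nonpositive oriented area. It remains to bound [PI * f s ^ 2] by
    [(1/4 + PI / (2 k) * cot (PI / k)) * Q f].
    For [s = 0] put [phi t = f t - nu * t * sin t / 2]. As [t sin t / 2] solves
    [g'' + g = cos], the mixed term of [Q phi] is [- 2 nu PI f 0]. On each arc of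
    length [d < PI] a calibration bounds the integral of [phi'^2 - phi^2] below
    by a quadratic form in the end values, and the sum of these forms is
    controlled by the Wirtinger inequality for cyclic sequences, with a defect
    depending only on the sum of the values of [phi] at the nodes [j d], which is
    [nu * PI / 2 * cot (PI / k)]. Optimizing in [nu] gives the bound. *)
Require Import Defs.
From Stdlib Require Import ssreflect Reals Lra Lia.
From Coquelicot Require Import Coquelicot.
Unset SsrRewrite.
Open Scope R_scope.


(** * Finite sums and trigonometric sums over roots of unity *)

Lemma cos_mul_period (m : nat) (x : R) : cos (x + INR m * (2 * PI)) = cos x.
Proof. rewrite <- (cos_period x m); f_equal; ring. Qed.

Lemma sin_mul_period (m : nat) (x : R) : sin (x + INR m * (2 * PI)) = sin x.
Proof. rewrite <- (sin_period x m); f_equal; ring. Qed.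

Lemma sum_lin2 (a b : R) (f g : nat -> R) (n : nat) :
  sum_f_R0 (fun j => a * f j + b * g j) n = a * sum_f_R0 f n + b * sum_f_R0 g n.
Proof. induction n as [|n IH]; simpl; [ring | rewrite IH; ring]. Qed.

Lemma sum_centered (M : R) (f g : nat -> R) (n : nat) :
  sum_f_R0 (fun j => (f j - M) * (g j - M)) n
  = sum_f_R0 (fun j => f j * g j) n - M * sum_f_R0 f n - M * sum_f_R0 g n
    + M ^ 2 * INR (S n).
Proof.
  induction n as [|n IH]; [simpl; ring|].
  rewrite !tech5, IH, (S_INR (S n)); ring.
Qed.

Lemma sum_single (n i : nat) (c : nat -> R) :
  (i <= n)%nat -> (forall j, (j <= n)%nat -> j <> i -> c j = 0) ->
  sum_f_R0 c n = c i.
Proof.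
  intros Hi Hc; induction n as [|n IH].
  - now replace i with O by lia.
  - simpl; destruct (Nat.eq_dec i (S n)) as [->|Hne].
    + rewrite (sum_eq _ (fun _ => 0)), sum_cte; [ring|].
      intros j Hj; apply Hc; lia.
    + rewrite IH, (Hc (S n)); [ring | lia | lia | lia |].
      intros j Hj; apply Hc; lia.
Qed.

Lemma sum_f_R0_exchange (F : nat -> nat -> R) (n p : nat) :
  sum_f_R0 (fun i => sum_f_R0 (F i) p) n
  = sum_f_R0 (fun j => sum_f_R0 (fun i => F i j) n) p.
Proof.
  induction n as [|n IH]; simpl; [reflexivity|].
  now rewrite IH, <- plus_sum.
Qed.

Lemma sum_mult_sum (f g : nat -> R) (n p : nat) :
  sum_f_R0 f n * sum_f_R0 g p
  = sum_f_R0 (fun i => sum_f_R0 (fun j => f i * g j) p) n.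
Proof.
  rewrite Rmult_comm, scal_sum; apply sum_eq; intros i _.
  rewrite scal_sum; apply sum_eq; intros; ring.
Qed.

(** Telescoping: [2 * sin (th / 2) * cos x] is [sin (x + th / 2) - sin (x - th / 2)]. *)
Lemma sum_cos_closed (a th : R) (n : nat) :
  2 * sin (th / 2) * sum_f_R0 (fun m => cos (a + INR m * th)) n
  = sin (a + INR (S n) * th - th / 2) - sin (a - th / 2).
Proof.
  induction n as [|n IH].
  - simpl; rewrite Rmult_0_l, Rplus_0_r.
    replace (a + 1 * th - th / 2) with (a + th / 2) by field.
    rewrite sin_plus, sin_minus; ring.
  - rewrite tech5, Rmult_plus_distr_l, IH.
    rewrite (S_INR (S n)); set (x := a + INR (S n) * th).
    replace (a + (INR (S n) + 1) * th - th / 2) with (x + th / 2) by (unfold x; field).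
    rewrite (sin_plus x), (sin_minus x); ring.
Qed.

(** This evaluates the sum of [t * sin t / 2] over the nodes [j * d]. The factor
    [4 * sin (th / 2) ^ 2] clears the denominators, so that induction needs no division. *)
Lemma sum_mul_sin_closed (th : R) (n : nat) :
  4 * sin (th / 2) ^ 2 * sum_f_R0 (fun j => INR j * sin (INR j * th)) n
  = sin (INR n * th) - 2 * INR n * sin (th / 2) * cos (INR n * th + th / 2).
Proof.
  induction n as [|n IH].
  - simpl; rewrite !Rmult_0_l, sin_0; ring.
  - rewrite tech5, Rmult_plus_distr_l, IH, S_INR.
    set (x := INR n * th); set (y := th / 2).
    replace ((INR n + 1) * th) with (x + 2 * y) by (unfold x, y; field).
    (* Centred at [z], the angles are [z - y], [z + y] and [z + 2 * y]; expanding leaves a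
       polynomial identity modulo [sin y ^ 2 + cos y ^ 2 = 1]. *)
    set (z := x + y).
    replace (x + 2 * y + y) with (z + 2 * y) by (unfold z; ring).
    replace (x + 2 * y) with (z + y) by (unfold z; ring).
    replace x with (z - y) by (unfold z; ring).
    rewrite cos_plus, (sin_plus z), (sin_minus z), cos_2a, sin_2a.
    pose proof (sin2_cos2 y) as E; unfold Rsqr in E.
    replace (cos y * cos y) with (1 - sin y * sin y) by lra.
    ring.
Qed.

Lemma sin_half_angle_pos (n x : nat) :
  (0 < x < S n)%nat -> 0 < sin (INR x * (2 * PI / INR (S n)) / 2).
Proof.
  intros [H0 H1]; pose proof PI_RGT_0 as HP.
  assert (Hk : 0 < INR (S n)) by (apply lt_0_INR; lia).
  assert (Hx : 0 < INR x) by (now apply lt_0_INR).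
  assert (Hxk : INR x < INR (S n)) by (now apply lt_INR).
  replace (INR x * (2 * PI / INR (S n)) / 2) with (PI * (INR x / INR (S n))) by (field; lra).
  assert (0 < INR x / INR (S n)) by (now apply Rdiv_lt_0_compat).
  assert (INR x / INR (S n) < 1) by (apply (Rmult_lt_reg_r (INR (S n))); [easy|]; field_simplify; lra).
  apply sin_gt_0; nra.
Qed.

Lemma sum_cos_roots (n x : nat) (a : R) :
  (0 < x < S n)%nat ->
  sum_f_R0 (fun m => cos (a + INR m * (INR x * (2 * PI / INR (S n))))) n = 0.
Proof.
  intros Hx; pose proof (sin_half_angle_pos n x Hx) as Hs.
  pose proof (sum_cos_closed a (INR x * (2 * PI / INR (S n))) n) as E.
  set (th := INR x * (2 * PI / INR (S n))) in *.
  (* After [S n] steps the angle has advanced by [x] full turns, so the two ends of the telescoped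
     sum cancel. *)
  replace (a + INR (S n) * th - th / 2) with (a - th / 2 + INR x * (2 * PI)) in E
    by (unfold th; field; apply not_0_INR; lia).
  rewrite sin_mul_period in E.
  apply (Rmult_eq_reg_l (2 * sin (th / 2))); lra.
Qed.

(** * Discrete Fourier transform and the cyclic Wirtinger inequality *)

Section Discrete_Fourier.
Variable n : nat.
Let d := 2 * PI / INR (S n).
(** [Ck] and [Sk] are the cosine and sine parts of the discrete Fourier transform on the cyclic
    group of order [S n], kept real to avoid complex numbers. *)
Let Ck (y : nat -> R) (m : nat) := sum_f_R0 (fun j => y j * cos (INR m * (INR j * d))) n.
Let Sk (y : nat -> R) (m : nat) := sum_f_R0 (fun j => y j * sin (INR m * (INR j * d))) n.

(** Expanding the products and summing over [m] first leaves sums of [cos (m * (i - j) * d)], which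
    vanish off the diagonal [i = j]. *)
Lemma parseval (y z : nat -> R) :
  sum_f_R0 (fun m => Ck y m * Ck z m + Sk y m * Sk z m) n
  = INR (S n) * sum_f_R0 (fun j => y j * z j) n.
Proof.
  transitivity (sum_f_R0 (fun m => sum_f_R0 (fun i => sum_f_R0 (fun j =>
     y i * z j * cos (INR m * (INR i * d - INR j * d))) n) n) n).
  { apply sum_eq; intros m _; unfold Ck, Sk.
    rewrite !sum_mult_sum, <- plus_sum; apply sum_eq; intros i _.
    rewrite <- plus_sum; apply sum_eq; intros j _.
    rewrite Rmult_minus_distr_l, cos_minus; ring. }
  rewrite sum_f_R0_exchange, scal_sum; apply sum_eq; intros i Hi.
  rewrite sum_f_R0_exchange.
  rewrite (sum_single n i); [|easy|].
  - rewrite (sum_eq _ (fun _ => y i * z i)), sum_cte; [ring|].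
    intros m _; rewrite Rminus_diag, Rmult_0_r, cos_0; ring.
  - intros j Hj Hne.
    rewrite (sum_eq _ (fun m => cos (INR m * (INR i * d - INR j * d)) * (y i * z j)))
      by (intros; ring).
    rewrite <- scal_sum.
    destruct (Nat.lt_total i j) as [H|[H|H]]; [|lia|].
    + rewrite (sum_eq _ (fun m => cos (0 + INR m * (INR (j - i) * d)))).
      * unfold d; rewrite sum_cos_roots; [ring|lia].
      * intros m _; rewrite minus_INR by lia; rewrite <- cos_neg; f_equal; ring.
    + rewrite (sum_eq _ (fun m => cos (0 + INR m * (INR (i - j) * d)))).
      * unfold d; rewrite sum_cos_roots; [ring|lia].
      * intros m _; rewrite minus_INR by lia; f_equal; ring.
Qed.

Lemma sum_cyclic (F : nat -> R) :
  F (S n) = F O -> sum_f_R0 (fun j => F (S j)) n = sum_f_R0 F n.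
Proof.
  intros HF.
  destruct n as [|p]; [simpl; congruence|].
  rewrite tech5, HF, (decomp_sum F) by lia; simpl pred; ring.
Qed.

(** The angles [m * d] lie in [[d, 2 * PI - d]], where the cosine is largest at the ends. *)
Lemma cos_harmonic_le (m : nat) :
  (0 < m < S n)%nat -> cos (INR m * d) <= cos d.
Proof.
  intros [H0 H1]; pose proof PI_RGT_0 as HP.
  assert (Hk : 0 < INR (S n)) by (apply lt_0_INR; lia).
  assert (Hkd : INR (S n) * d = 2 * PI) by (unfold d; field; lra).
  assert (Hd : 0 < d) by (unfold d; apply Rdiv_lt_0_compat; lra).
  assert (Hm : 1 <= INR m) by (apply (le_INR 1); lia).
  assert (Hm' : INR m + 1 <= INR (S n)) by (rewrite <- S_INR; apply le_INR; lia).
  assert (d <= PI) by nra.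
  destruct (Rle_dec (INR m * d) PI) as [Hle|Hgt].
  - apply cos_decr_1; nra.
  - replace (cos (INR m * d)) with (cos (INR (S n) * d - INR m * d)).
    + apply cos_decr_1; nra.
    + rewrite Hkd, <- cos_neg.
      replace (- (2 * PI - INR m * d)) with (INR m * d - 2 * PI) by ring.
      rewrite cos_minus, cos_2PI, sin_2PI; ring.
Qed.

(** The cyclic shift rotates the pair of coefficients at frequency [m] by the angle [m * d]. By
    [parseval] the left side is thus an average of [cos (m * d)] weighted by the energies, and the
    zero mean removes [m = 0]. *)
Lemma discrete_wirtinger (y : nat -> R) :
  y (S n) = y O -> sum_f_R0 y n = 0 ->
  sum_f_R0 (fun j => y j * y (S j)) n <= cos d * sum_f_R0 (fun j => y j * y j) n.
Proof.
  intros Hper Hsum.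
  assert (Hk : 0 < INR (S n)) by (apply lt_0_INR; lia).
  assert (Hkd : INR (S n) * d = 2 * PI) by (unfold d; field; lra).
  pose proof (parseval y y) as P1.
  pose proof (parseval y (fun j => y (S j))) as P2.
  assert (HC : forall m, Ck (fun j => y (S j)) m = cos (INR m * d) * Ck y m + sin (INR m * d) * Sk y m).
  { intros m; unfold Ck, Sk.
    rewrite <- sum_lin2; etransitivity; [|apply sum_cyclic].
    - apply sum_eq; intros j _.
      replace (INR m * (INR j * d)) with (INR m * (INR (S j) * d) - INR m * d) by (rewrite S_INR; ring).
      rewrite cos_minus; ring.
    - cbv beta; rewrite Hper, Hkd, <- (Rplus_0_l (INR m * (2 * PI))), cos_mul_period, sin_mul_period.
      now rewrite Rmult_0_l, Rmult_0_r. }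
  assert (HS : forall m, Sk (fun j => y (S j)) m = cos (INR m * d) * Sk y m + - sin (INR m * d) * Ck y m).
  { intros m; unfold Ck, Sk.
    rewrite <- sum_lin2; etransitivity; [|apply sum_cyclic].
    - apply sum_eq; intros j _.
      replace (INR m * (INR j * d)) with (INR m * (INR (S j) * d) - INR m * d) by (rewrite S_INR; ring).
      rewrite sin_minus; ring.
    - cbv beta; rewrite Hper, Hkd, <- (Rplus_0_l (INR m * (2 * PI))), cos_mul_period, sin_mul_period.
      now rewrite Rmult_0_l, Rmult_0_r. }
  assert (HL : sum_f_R0 (fun m => Ck y m * Ck (fun j => y (S j)) m + Sk y m * Sk (fun j => y (S j)) m) n
    <= sum_f_R0 (fun m => (Ck y m * Ck y m + Sk y m * Sk y m) * cos d) n).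
  { apply sum_Rle; intros m Hm; rewrite HC, HS.
    destruct (Nat.eq_dec m 0) as [->|Hm0].
    - assert (C0 : Ck y 0 = 0).
      { unfold Ck; rewrite <- Hsum; apply sum_eq; intros; simpl INR; rewrite Rmult_0_l, cos_0; ring. }
      assert (S0 : Sk y 0 = 0).
      { unfold Sk; rewrite (sum_eq _ (fun _ => 0)), sum_cte; [ring|].
        intros; simpl INR; rewrite Rmult_0_l, sin_0; ring. }
      rewrite C0, S0; lra.
    - pose proof (cos_harmonic_le m ltac:(lia)); nra. }
  rewrite P2, <- scal_sum, P1 in HL.
  apply (Rmult_le_reg_l (INR (S n))); [easy|]; lra.
Qed.

(** The mean-free inequality is applied to [y] minus its mean [M]; the last term is the contribution
    of the constant sequence. *)
Lemma discrete_wirtinger_mean (y : nat -> R) :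
  y (S n) = y O ->
  sum_f_R0 (fun j => y j * y (S j)) n
  <= cos d * sum_f_R0 (fun j => y j * y j) n
     + (1 - cos d) * sum_f_R0 y n ^ 2 / INR (S n).
Proof.
  intros Hper.
  assert (Hk : 0 < INR (S n)) by (apply lt_0_INR; lia).
  set (M := sum_f_R0 y n / INR (S n)).
  assert (HM : sum_f_R0 y n = M * INR (S n)) by (unfold M; field; lra).
  pose proof (discrete_wirtinger (fun j => y j - M)) as W; simpl in W.
  rewrite Hper, minus_sum, sum_cte, HM in W.
  specialize (W eq_refl ltac:(ring)).
  rewrite !sum_centered, (sum_cyclic y Hper), HM in W.
  rewrite HM.
  replace ((1 - cos d) * (M * INR (S n)) ^ 2 / INR (S n)) with ((1 - cos d) * M ^ 2 * INR (S n))
    by (field; lra).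
  nra.
Qed.
End Discrete_Fourier.

(* Equalities between [RInt]s live in the carrier of [R_CompleteNormedModule],
   which [ring] and [field] do not recognise as [R]. *)
Ltac eq_in_R := match goal with |- ?x = ?y => change (@eq R x y) end.

(** * Continuously differentiable functions *)

(** The derivative is carried as an explicit function, so that combinations and shifts never have to
    rewrite under [Derive]. *)
Definition is_C1 (g g' : R -> R) : Prop :=
  (forall t, is_derive g t (g' t)) /\ (forall t, continuous g' t).

Lemma is_C1_continuous (g g' : R -> R) (t : R) : is_C1 g g' -> continuous g t.
Proof. intros [H _]; apply (ex_derive_continuous (K := R_AbsRing) (V := R_NormedModule)); now exists (g' t). Qed.

Lemma is_C1_ext (f g f' g' : R -> R) :
  (forall t, f t = g t) -> (forall t, f' t = g' t) -> is_C1 f f' -> is_C1 g g'.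
Proof.
  intros H H' [D C]; split; intros t.
  - rewrite <- H'; apply (is_derive_ext f); auto.
  - apply (continuous_ext f'); auto.
Qed.

Lemma is_C1_lin2 (a b : R) (f g f' g' : R -> R) :
  is_C1 f f' -> is_C1 g g' ->
  is_C1 (fun t => a * f t + b * g t) (fun t => a * f' t + b * g' t).
Proof.
  intros [Df Cf] [Dg Cg]; split; intros t.
  - apply: is_derive_plus; apply: is_derive_scal; auto.
  - apply: continuous_plus; apply: continuous_scal_r; auto.
Qed.

Lemma is_C1_const (a : R) : is_C1 (fun _ => a) (fun _ => 0).
Proof. split; intros t; [apply: is_derive_const | apply continuous_const]. Qed.

Lemma is_C1_shift (f f' : R -> R) (s : R) :
  is_C1 f f' -> is_C1 (fun t => f (s + t)) (fun t => f' (s + t)).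
Proof.
  intros [D C]; split; intros t.
  - evar_last; [apply: (is_derive_comp f (fun t => s + t)); [apply D|]|].
    + auto_derive; [easy | reflexivity].
    + unfold scal, mult; simpl; unfold mult; simpl; ring.
  - apply (continuous_comp (fun t => s + t) f'); [|apply C].
    apply: continuous_plus; [apply continuous_const | apply continuous_id].
Qed.

Lemma continuous_mult_fun (f g : R -> R) :
  (forall t, continuous f t) -> (forall t, continuous g t) ->
  forall t, continuous (fun t => f t * g t) t.
Proof. intros Hf Hg t; now apply: continuous_mult. Qed.

Lemma continuous_minus_fun (f g : R -> R) :
  (forall t, continuous f t) -> (forall t, continuous g t) ->
  forall t, continuous (fun t => f t - g t) t.
Proof. intros Hf Hg t; now apply: continuous_minus. Qed.

(** * Integrals and the polarised energy form *)

Lemma ex_RInt_cont (f : R -> R) (a b : R) : (forall t, continuous f t) -> ex_RInt f a b.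
Proof. intros H; apply (ex_RInt_continuous (V := R_CompleteNormedModule)); intros; apply H. Qed.

Lemma RInt_eq (f g : R -> R) (a b : R) :
  (forall t, f t = g t) -> RInt f a b = RInt g a b.
Proof. intros H; apply RInt_ext; intros t _; apply H. Qed.

(* The polarised form of [RInt (fun t => g' t ^ 2 - g t ^ 2) a b]. *)
Definition bform (a b : R) (f f' g g' : R -> R) : R :=
  RInt (fun t => f' t * g' t - f t * g t) a b.

Lemma continuous_bform (f f' g g' : R -> R) (t : R) :
  is_C1 f f' -> is_C1 g g' -> continuous (fun t => f' t * g' t - f t * g t) t.
Proof.
  intros Hf Hg; apply: continuous_minus; apply: continuous_mult.
  - apply Hf.
  - apply Hg.
  - now apply (is_C1_continuous _ f').
  - now apply (is_C1_continuous _ g').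
Qed.

Lemma ex_RInt_bform (a b : R) (f f' g g' : R -> R) :
  is_C1 f f' -> is_C1 g g' -> ex_RInt (fun t => f' t * g' t - f t * g t) a b.
Proof. intros Hf Hg; apply ex_RInt_cont; intros t; now apply continuous_bform. Qed.

Lemma bform_sym (a b : R) (f f' g g' : R -> R) : bform a b f f' g g' = bform a b g g' f f'.
Proof. apply RInt_eq; intros t; ring. Qed.

Lemma RInt_lin2 (al be a b : R) (f g : R -> R) :
  ex_RInt f a b -> ex_RInt g a b ->
  RInt (fun t => al * f t + be * g t) a b = al * RInt f a b + be * RInt g a b.
Proof.
  intros Hf Hg; apply is_RInt_unique, (is_RInt_plus (V := R_NormedModule) (fun t => al * f t) (fun t => be * g t));
  apply (is_RInt_scal (V := R_NormedModule)); now apply (RInt_correct (V := R_CompleteNormedModule)).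
Qed.

Lemma bform_lin2 (a b al be : R) (f f' g g' w w' : R -> R) :
  is_C1 f f' -> is_C1 g g' -> is_C1 w w' ->
  bform a b (fun t => al * f t + be * g t) (fun t => al * f' t + be * g' t) w w'
  = al * bform a b f f' w w' + be * bform a b g g' w w'.
Proof.
  intros Hf Hg Hw; unfold bform.
  rewrite <- RInt_lin2 by now apply ex_RInt_bform.
  apply RInt_eq; intros t; ring.
Qed.

Lemma bform_square_lin2 (a b al be : R) (f f' g g' : R -> R) :
  is_C1 f f' -> is_C1 g g' ->
  bform a b (fun t => al * f t + be * g t) (fun t => al * f' t + be * g' t)
            (fun t => al * f t + be * g t) (fun t => al * f' t + be * g' t)
  = al ^ 2 * bform a b f f' f f' + 2 * al * be * bform a b f f' g g'
    + be ^ 2 * bform a b g g' g g'.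
Proof.
  intros Hf Hg; pose proof (is_C1_lin2 al be _ _ _ _ Hf Hg) as H.
  rewrite bform_lin2, (bform_sym _ _ f), (bform_sym _ _ g), !bform_lin2 by easy.
  rewrite (bform_sym _ _ g g' f f'); ring.
Qed.

Lemma RInt_of_derive (F F' : R -> R) (a b : R) :
  is_C1 F F' -> RInt F' a b = F b - F a.
Proof.
  intros [D C]; apply is_RInt_unique, (is_RInt_derive (V := R_CompleteNormedModule) F F'); auto.
Qed.

(** Integrating the derivative of [f * g'] leaves [f] paired with [g'' + g]; the form becomes
    explicit when [g] solves a forced oscillator equation. *)
Lemma bform_by_parts (a b : R) (f f' g g' g'' : R -> R) :
  is_C1 f f' -> is_C1 g g' -> is_C1 g' g'' ->
  bform a b f f' g g' = f b * g' b - f a * g' a - RInt (fun t => f t * (g'' t + g t)) a b.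
Proof.
  intros Hf Hg Hg'.
  pose proof (fun t => is_C1_continuous f f' t Hf) as cf.
  pose proof (fun t => is_C1_continuous g g' t Hg) as cg.
  rewrite <- (RInt_of_derive (fun t => f t * g' t) (fun t => f' t * g' t + f t * g'' t)).
  - replace (_ - _) with (1 * RInt (fun t => f' t * g' t + f t * g'' t) a b
      + -1 * RInt (fun t => f t * (g'' t + g t)) a b) by ring.
    rewrite <- RInt_lin2.
    + apply RInt_eq; intros t; ring.
    + apply ex_RInt_cont; intros t; apply: continuous_plus; apply: continuous_mult;
        auto; [apply Hf | apply Hg | apply Hg'].
    + apply ex_RInt_cont; intros t; apply: continuous_mult; auto.
      apply: continuous_plus; auto; apply Hg'.
  - split; intros t.
    + apply: is_derive_mult; [apply Hf | apply Hg' | intros; apply Rmult_comm].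
    + apply: continuous_plus; apply: continuous_mult;
        auto; [apply Hf | apply Hg | apply Hg'].
Qed.

(** * Lower bounds for the energy on an arc and on the circle *)

(* Calibration: write [f = u + w] with [u'' + u = 0] and [w] vanishing at both
   ends. The integrand minus the derivative of
   [u u' + 2 w u' - w^2 tan (t - (p + d / 2))] is the square of
   [w' + w tan (t - (p + d / 2))]. *)
Lemma arc_lemma (p d : R) (f f' : R -> R) :
  0 < d < PI -> is_C1 f f' ->
  ((f p ^ 2 + f (p + d) ^ 2) * cos d - 2 * f p * f (p + d)) / sin d
  <= bform p (p + d) f f' f f'.
Proof.
  intros Hd Hf.
  assert (Hs : 0 < sin d) by (apply sin_gt_0; lra).
  set (A := f p); set (B := f (p + d)); set (m := p + d / 2).
  set (u := fun t => (A * sin (p + d - t) + B * sin (t - p)) / sin d).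
  set (u' := fun t => (- A * cos (p + d - t) + B * cos (t - p)) / sin d).
  set (Phi := fun t => u t * u' t + 2 * (f t - u t) * u' t
                       - (f t - u t) ^ 2 * tan (t - m)).
  set (Phi' := fun t => (f' t * f' t - f t * f t)
                        - (f' t - u' t + (f t - u t) * tan (t - m)) ^ 2).
  (* Since [m] is the midpoint of the arc and [d < PI], the argument of [tan] stays within
     [(- PI / 2, PI / 2)]. *)
  assert (Hc : forall t, p <= t <= p + d -> cos (t - m) <> 0).
  { intros t Ht; apply Rgt_not_eq, cos_gt_0; unfold m; lra. }
  assert (Du : forall t, is_derive u t (u' t)).
  { intros t; unfold u, u'; auto_derive; [easy|]; unfold Rminus, Rdiv; ring. }
  assert (Du' : forall t, is_derive u' t (- u t)).
  { intros t; unfold u, u'; auto_derive; [easy|]; unfold Rminus, Rdiv; ring. }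
  assert (cu : forall t, continuous u t).
  { intros t; apply (ex_derive_continuous (K := R_AbsRing) (V := R_NormedModule)); eexists; apply Du. }
  assert (cu' : forall t, continuous u' t).
  { intros t; apply (ex_derive_continuous (K := R_AbsRing) (V := R_NormedModule)); eexists; apply Du'. }
  assert (HPhi : is_RInt Phi' p (p + d) (minus (Phi (p + d)) (Phi p))).
  { apply (is_RInt_derive (V := R_CompleteNormedModule)); rewrite Rmin_left, Rmax_right by lra;
      intros t Ht; specialize (Hc t Ht).
    - unfold Phi.
      evar_last.
      { apply: is_derive_minus.
        - apply: is_derive_plus; [apply: is_derive_mult; [apply Du | apply Du' | intros; apply Rmult_comm]|].
          apply: is_derive_mult; [| apply Du' | intros; apply Rmult_comm].
          apply: is_derive_scal; apply: is_derive_minus; [apply Hf | apply Du].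
        - apply: is_derive_mult; [| | intros; apply Rmult_comm].
          + apply: is_derive_pow; apply: is_derive_minus; [apply Hf | apply Du].
          + apply: (is_derive_comp tan (fun t => t - m)); [now apply is_derive_tan|].
            auto_derive; [easy | reflexivity]. }
      unfold minus, plus, opp, scal, Phi'; simpl; unfold mult; simpl.
      unfold u'; ring.
    - unfold Phi'; apply: continuous_minus.
      + now apply (continuous_bform f f' f f').
      + assert (Ct : continuous (fun t => f' t - u' t + (f t - u t) * tan (t - m)) t).
        { apply: continuous_plus; [apply: continuous_minus; [apply Hf | apply cu']|].
          apply: continuous_mult; [apply: continuous_minus; [now apply (is_C1_continuous f f') | apply cu]|].
          apply (ex_derive_continuous (K := R_AbsRing) (V := R_NormedModule)).
          auto_derive; eexists; now apply is_derive_tan. }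
        apply (continuous_ext (fun t => (f' t - u' t + (f t - u t) * tan (t - m)) * ((f' t - u' t + (f t - u t) * tan (t - m)) * 1))); [easy|].
        do 2 (apply: continuous_mult; [exact Ct|]); apply continuous_const. }
  replace (_ / sin d) with (RInt Phi' p (p + d)).
  - apply RInt_le; [lra | eexists; apply HPhi | now apply ex_RInt_bform |].
    intros t _; unfold Phi'; pose proof (pow2_ge_0 (f' t - u' t + (f t - u t) * tan (t - m))); lra.
  (* As [f - u] vanishes at both ends, only the increment of [u * u'] remains, and it is the
     quadratic form in [A] and [B]. *)
  - rewrite (is_RInt_unique _ _ _ _ HPhi).
    assert (up : u p = f p).
    { unfold u; replace (p + d - p) with d by ring; rewrite Rminus_diag, sin_0; fold A; field; lra. }
    assert (uq : u (p + d) = f (p + d)).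
    { unfold u; replace (p + d - p) with d by ring; rewrite Rminus_diag, sin_0; fold B; field; lra. }
    unfold minus, plus, opp, Phi; simpl; rewrite up, uq; fold A B.
    unfold u'; replace (p + d - p) with d by ring; rewrite !Rminus_diag, cos_0; field; lra.
Qed.

Lemma bform_Chasles (a b c : R) (f f' g g' : R -> R) :
  is_C1 f f' -> is_C1 g g' ->
  bform a b f f' g g' + bform b c f f' g g' = bform a c f f' g g'.
Proof.
  intros Hf Hg; apply (RInt_Chasles (V := R_CompleteNormedModule)); now apply ex_RInt_bform.
Qed.

Lemma sum_arcs_le (d : R) (f f' : R -> R) (n : nat) :
  0 < d < PI -> is_C1 f f' ->
  sum_f_R0 (fun j => ((f (INR j * d) ^ 2 + f (INR (S j) * d) ^ 2) * cos d
                      - 2 * f (INR j * d) * f (INR (S j) * d)) / sin d) n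
  <= bform 0 (INR (S n) * d) f f' f f'.
Proof.
  intros Hd Hf.
  assert (step : forall j, ((f (INR j * d) ^ 2 + f (INR (S j) * d) ^ 2) * cos d
       - 2 * f (INR j * d) * f (INR (S j) * d)) / sin d
     <= bform (INR j * d) (INR (S j) * d) f f' f f').
  { intros j; pose proof (arc_lemma (INR j * d) d f f' Hd Hf) as H.
    replace (INR j * d + d) with (INR (S j) * d) in H by (rewrite S_INR; ring); exact H. }
  induction n as [|n IH].
  - pose proof (step O) as H0; simpl in *; rewrite Rmult_0_l in *; exact H0.
  - rewrite tech5, <- (bform_Chasles 0 (INR (S n) * d)) by easy.
    apply Rplus_le_compat; auto.
Qed.

(** With at least three arcs [d < PI], so [arc_lemma] applies to each. By cyclicity the forms add up
    to [(2 * cos d * Q - 2 * P) / sin d], with [Q] the sum of squares of the node values and [P]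
    that of neighbouring products, and [discrete_wirtinger_mean] bounds this below. *)
Lemma circle_lower_bound (n : nat) (f f' : R -> R) :
  (2 <= n)%nat -> is_C1 f f' -> f (2 * PI) = f 0 ->
  let d := 2 * PI / INR (S n) in
  - 2 * ((1 - cos d) / sin d) * sum_f_R0 (fun j => f (INR j * d)) n ^ 2 / INR (S n)
  <= bform 0 (2 * PI) f f' f f'.
Proof.
  intros Hn Hf Hper d; pose proof PI_RGT_0 as HP.
  assert (Hk : 3 <= INR (S n)) by (replace 3 with (INR 3) by (simpl; ring); apply le_INR; lia).
  assert (Hkd : INR (S n) * d = 2 * PI) by (unfold d; field; lra).
  assert (Hd : 0 < d < PI).
  { split; [unfold d; apply Rdiv_lt_0_compat; lra | nra]. }
  assert (Hs : 0 < sin d) by (apply sin_gt_0; lra).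
  pose proof (sum_arcs_le d f f' n Hd Hf) as H; rewrite Hkd in H.
  refine (Rle_trans _ _ _ _ H); clear H.
  set (y := fun j => f (INR j * d)).
  assert (Hy : y (S n) = y O) by (unfold y; rewrite Hkd, Rmult_0_l; exact Hper).
  pose proof (discrete_wirtinger_mean n y Hy) as W; fold d in W.
  rewrite (sum_eq (fun j => _ / sin d) (fun j => (cos d / sin d) * (1 * (y j * y j) + 1 * (y (S j) * y (S j)))
      + (- 2 / sin d) * (y j * y (S j)))) by (intros; unfold y; field; lra).
  rewrite sum_lin2, sum_lin2, (sum_cyclic n (fun j => y j * y j)) by (now rewrite Hy).
  fold y; set (P := sum_f_R0 (fun j => y j * y (S j)) n) in *.
  set (Q := sum_f_R0 (fun j => y j * y j) n) in *; set (M := sum_f_R0 y n) in *.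
  apply (Rmult_le_reg_l (sin d)); [easy|].
  replace (sin d * (cos d / sin d * (1 * Q + 1 * Q) + - 2 / sin d * P)) with (2 * (cos d * Q) - 2 * P)
    by (field; lra).
  replace (sin d * (- 2 * ((1 - cos d) / sin d) * M ^ 2 / INR (S n)))
    with (- 2 * ((1 - cos d) * M ^ 2 / INR (S n))) by (field; lra).
  lra.
Qed.

(** * Point evaluation bounded by the energy *)

(** The summand [/ 4] is the energy of [t * sin t / 2] divided by [PI]; the cotangent term is the
    defect caused by its node sum. The constant of the theorem is [2 * PI ^ 2 / peak_constant k]. *)
Definition peak_constant (k : R) : R := / 4 + PI / (2 * k) * (cos (PI / k) / sin (PI / k)).

(* On [0, 2 pi] the function t sin t / 2 solves g'' + g = cos, so it represents
   evaluation at 0 on functions orthogonal to cos. *)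
Lemma is_C1_psi :
  is_C1 (fun t => t * sin t / 2) (fun t => (sin t + t * cos t) / 2).
Proof.
  split; intros t.
  - auto_derive; [easy | field].
  - apply (ex_derive_continuous (K := R_AbsRing) (V := R_NormedModule)); auto_derive; easy.
Qed.

Lemma is_C1_psi' :
  is_C1 (fun t => (sin t + t * cos t) / 2) (fun t => cos t - t * sin t / 2).
Proof.
  split; intros t.
  - auto_derive; [easy | field].
  - apply (ex_derive_continuous (K := R_AbsRing) (V := R_NormedModule)); auto_derive; easy.
Qed.

(** The derivative of [t * sin t / 2] is [0] at [0] and [PI] at [2 * PI], so the boundary term is
    [PI * f (2 * PI)]. *)
Lemma bform_psi (f f' : R -> R) :
  is_C1 f f' ->
  bform 0 (2 * PI) f f' (fun t => t * sin t / 2) (fun t => (sin t + t * cos t) / 2)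
  = PI * f (2 * PI) - RInt (fun t => f t * cos t) 0 (2 * PI).
Proof.
  intros Hf; rewrite (bform_by_parts _ _ _ _ _ _ _ Hf is_C1_psi is_C1_psi').
  rewrite sin_2PI, cos_2PI, sin_0, (RInt_eq _ (fun t => f t * cos t)) by (intros; field).
  field.
Qed.

Lemma RInt_t_sin_cos : RInt (fun t => t * sin t / 2 * cos t) 0 (2 * PI) = - PI / 4.
Proof.
  (* The integrand is [t * sin (2 * t) / 4]; integration by parts gives this antiderivative, with
     the double angles expanded. *)
  rewrite (RInt_of_derive (fun t => (- t * (1 - 2 * (sin t * sin t)) + sin t * cos t) / 8)).
  - rewrite sin_2PI, cos_2PI, sin_0; eq_in_R; field.
  - split; intros t.
    + auto_derive; [easy|].
      pose proof (sin2_cos2 t) as E; unfold Rsqr in E.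
      replace (sin t * (1 * - sin t)) with (cos t * cos t - 1) by lra.
      replace (sin t * sin t) with (1 - cos t * cos t) by lra; field.
    + apply (ex_derive_continuous (K := R_AbsRing) (V := R_NormedModule)); auto_derive; easy.
Qed.

Lemma evaluation_at_zero_bound (n : nat) (f f' : R -> R) :
  (2 <= n)%nat -> is_C1 f f' -> f (2 * PI) = f 0 ->
  RInt (fun t => f t * cos t) 0 (2 * PI) = 0 ->
  sum_f_R0 (fun j => f (INR j * (2 * PI / INR (S n)))) n = 0 ->
  PI * f 0 ^ 2 <= peak_constant (INR (S n)) * bform 0 (2 * PI) f f' f f'.
Proof.
  intros Hn Hf Hper Hcos Hsum; pose proof PI_RGT_0 as HP.
  assert (Hk : 3 <= INR (S n)) by (replace 3 with (INR 3) by (simpl; ring); apply le_INR; lia).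
  set (d := 2 * PI / INR (S n)) in *.
  set (s := sin (PI / INR (S n))); set (c := cos (PI / INR (S n))).
  assert (Hdh : d / 2 = PI / INR (S n)) by (unfold d; field; lra).
  assert (Hh : 0 < PI / INR (S n) < PI / 2).
  { split; [apply Rdiv_lt_0_compat; lra|].
    apply Rmult_lt_compat_l; [easy|]; apply Rinv_lt_contravar; lra. }
  assert (Hs : 0 < s) by (apply sin_gt_0; lra).
  assert (Hc : 0 < c) by (apply cos_gt_0; lra).
  set (K := peak_constant (INR (S n))).
  assert (HK : 0 < K).
  { unfold K, peak_constant; fold s c.
    assert (0 < PI / (2 * INR (S n)) * (c / s)).
    { apply Rmult_lt_0_compat; apply Rdiv_lt_0_compat; lra. }
    lra. }
  set (psi := fun t => t * sin t / 2); set (psi' := fun t => (sin t + t * cos t) / 2).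
  assert (Hpsi : is_C1 psi psi') by exact is_C1_psi.
  assert (Hpsisum : sum_f_R0 (fun j => psi (INR j * d)) n = - PI * c / (2 * s)).
  { pose proof (sum_mul_sin_closed d n) as E; rewrite Hdh in E; fold s in E.
    (* Since [S n * d] is a full turn, the last node lies at [- d] modulo [2 * PI]. *)
    replace (INR n * d + PI / INR (S n)) with (- (PI / INR (S n)) + INR 1 * (2 * PI)) in E
      by (unfold d; rewrite S_INR; simpl; field; rewrite <- S_INR; lra).
    replace (INR n * d) with (- (2 * (PI / INR (S n))) + INR 1 * (2 * PI)) in E
      by (unfold d; rewrite S_INR; simpl; field; rewrite <- S_INR; lra).
    rewrite sin_mul_period, cos_mul_period, sin_neg, cos_neg, sin_2a in E; fold s c in E.
    rewrite (sum_eq _ (fun j => INR j * sin (INR j * d) * (d / 2)))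
      by (intros; unfold psi; field).
    rewrite <- scal_sum.
    apply (Rmult_eq_reg_l (4 * s ^ 2)); [|nra].
    replace (4 * s ^ 2 * (d / 2 * sum_f_R0 (fun j => INR j * sin (INR j * d)) n))
      with (d / 2 * (4 * s ^ 2 * sum_f_R0 (fun j => INR j * sin (INR j * d)) n)) by ring.
    rewrite E; unfold d; rewrite S_INR; field; split; [lra | rewrite <- S_INR; lra]. }
  (* The bound will read [Q >= 2 * nu * PI * f 0 - nu ^ 2 * PI * K], with [Q] the energy of [f];
     this [nu] maximises the right side. *)
  set (nu := f 0 / K).
  assert (Hphi := is_C1_lin2 1 (- nu) _ _ _ _ Hf Hpsi).
  pose proof (circle_lower_bound n _ _ Hn Hphi) as B.
  fold d in B; cbv zeta beta in B.
  rewrite sum_lin2, Hsum, Hpsisum, bform_square_lin2 in B by easy.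
  unfold psi, psi' in B; rewrite !bform_psi, RInt_t_sin_cos, Hcos in B by (easy || exact is_C1_psi).
  (* Only the end values have to match: [psi] vanishes at [0] and [2 * PI], although its derivative
     differs there. *)
  rewrite sin_2PI, Hper, sin_0 in B; specialize (B ltac:(field)).
  assert (Ht : (1 - cos d) / sin d = s / c).
  { replace d with (2 * (PI / INR (S n))) by (rewrite <- Hdh; field).
    rewrite cos_2a_sin, sin_2a; fold s c; field; lra. }
  rewrite Ht in B.
  replace (-2 * (s / c) * (1 * 0 + - nu * (- PI * c / (2 * s))) ^ 2 / INR (S n))
    with (- (nu ^ 2 * PI * (K - / 4))) in B
    by (unfold K, peak_constant; fold s c; field; lra).
  assert (Hnu : f 0 = nu * K) by (unfold nu; field; lra).
  rewrite Hnu in *.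
  set (Q := bform 0 (2 * PI) f f' f f') in *.
  nra.
Qed.

(** * Translation to an arbitrary point *)

Lemma periodic_derive (f f' : R -> R) (T : R) :
  is_C1 f f' -> (forall t, f (t + T) = f t) -> forall t, f' (t + T) = f' t.
Proof.
  intros Hf Hper t.
  rewrite <- (is_derive_unique _ _ _ (proj1 Hf t)).
  rewrite (Rplus_comm t T), <- (is_derive_unique _ _ _ (proj1 (is_C1_shift f f' T Hf) t)).
  apply Derive_ext; intros x; rewrite Rplus_comm; apply Hper.
Qed.

Lemma RInt_shift (g : R -> R) (s a b : R) :
  (forall t, continuous g t) ->
  RInt (fun t => g (s + t)) a b = RInt g (s + a) (s + b).
Proof.
  intros Hg.
  replace (s + a) with (1 * a + s) by ring; replace (s + b) with (1 * b + s) by ring.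
  rewrite <- (RInt_comp_lin g) by now apply ex_RInt_cont.
  apply RInt_ext; intros t _; unfold scal; simpl; unfold mult; simpl.
  rewrite Rmult_1_l; f_equal; ring.
Qed.

Lemma RInt_periodic (g : R -> R) (T s : R) :
  (forall t, continuous g t) -> (forall t, g (t + T) = g t) ->
  RInt (fun t => g (s + t)) 0 T = RInt g 0 T.
Proof.
  intros Hg Hper; rewrite RInt_shift, Rplus_0_r by easy.
  assert (E : forall a b c, RInt g a b + RInt g b c = RInt g a c).
  { intros; apply (RInt_Chasles (V := R_CompleteNormedModule)); now apply ex_RInt_cont. }
  pose proof (RInt_shift g T 0 s Hg) as Es.
  rewrite (RInt_eq (fun t => g (T + t)) g) in Es by (intros; rewrite Rplus_comm; apply Hper).
  rewrite Rplus_0_r, (Rplus_comm T) in Es.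
  rewrite <- (E s T), <- (E s 0 T), <- Es.
  pose proof (E s 0 s) as Z; rewrite RInt_point in Z; unfold zero in Z; simpl in Z; lra.
Qed.

Lemma evaluation_bound (n : nat) (f f' : R -> R) (s : R) :
  (2 <= n)%nat -> is_C1 f f' -> (forall t, f (t + 2 * PI) = f t) ->
  RInt (fun t => f t * cos t) 0 (2 * PI) = 0 ->
  RInt (fun t => f t * sin t) 0 (2 * PI) = 0 ->
  (forall t, sum_f_R0 (fun j => f (t + INR j * (2 * PI / INR (S n)))) n = 0) ->
  PI * f s ^ 2 <= peak_constant (INR (S n)) * bform 0 (2 * PI) f f' f f'.
Proof.
  intros Hn Hf Hper Hcos Hsin Hsum.
  pose proof (fun t => is_C1_continuous f f' t Hf) as cf.
  pose proof (periodic_derive f f' _ Hf Hper) as Hper'.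
  assert (cfc : forall t, continuous (fun t => f t * cos t) t)
    by (intros t; apply: continuous_mult; [apply cf | apply continuous_cos]).
  assert (cfs : forall t, continuous (fun t => f t * sin t) t)
    by (intros t; apply: continuous_mult; [apply cf | apply continuous_sin]).
  pose proof (evaluation_at_zero_bound n _ _ Hn (is_C1_shift f f' s Hf)) as E; simpl in E.
  rewrite Rplus_0_r, Hper in E; specialize (E eq_refl).
  replace (bform 0 (2 * PI) f f' f f') with
    (bform 0 (2 * PI) (fun t => f (s + t)) (fun t => f' (s + t)) (fun t => f (s + t)) (fun t => f' (s + t))).
  - apply E; [|apply Hsum].
    (* [F t] is [f t * cos (t - s)]; hence orthogonality to both [cos] and [sin] is used after
       translation. *)
    pose (F := fun t => cos s * (f t * cos t) + sin s * (f t * sin t)).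
    rewrite (RInt_eq _ (fun t => F (s + t))).
    + rewrite RInt_periodic.
      * unfold F; rewrite RInt_lin2, Hcos, Hsin by now apply ex_RInt_cont. ring.
      * intros t; unfold F; apply: continuous_plus; apply: continuous_scal_r; auto.
      * intros t; unfold F; rewrite Hper, cos_plus, sin_plus, cos_2PI, sin_2PI; ring.
    + intros t; unfold F.
      replace (cos t) with (cos (s + t - s)) by (f_equal; ring); rewrite cos_minus; ring.
  - apply (RInt_periodic (fun t => f' t * f' t - f t * f t)).
    + intros t; now apply (continuous_bform f f' f f').
    + intros t; now rewrite Hper, Hper'.
Qed.

(** * Sums over rotation orbits and orthogonality *)

Lemma is_C1_sum (F F' : nat -> R -> R) (n : nat) :
  (forall j, is_C1 (F j) (F' j)) ->
  is_C1 (fun t => sum_f_R0 (fun j => F j t) n) (fun t => sum_f_R0 (fun j => F' j t) n).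
Proof.
  intros H; induction n as [|n IH]; simpl; [apply H|].
  eapply is_C1_ext; [| |exact (is_C1_lin2 1 1 _ _ _ _ IH (H (S n)))]; intros t; simpl; ring.
Qed.

Lemma is_C1_unique (f f' g' : R -> R) : is_C1 f f' -> is_C1 f g' -> forall t, f' t = g' t.
Proof.
  intros [Hf _] [Hg _] t.
  now rewrite <- (is_derive_unique _ _ _ (Hf t)), <- (is_derive_unique _ _ _ (Hg t)).
Qed.

Lemma periodic_iter (f : R -> R) (d : R) :
  (forall t, f (t + d) = f t) -> forall j t, f (t + INR j * d) = f t.
Proof.
  intros H j t; induction j as [|j IH].
  - simpl; f_equal; ring.
  - rewrite S_INR, Rmult_plus_distr_r, Rmult_1_l, <- Rplus_assoc, H; exact IH.
Qed.

Lemma continuous_shift (f : R -> R) (s : R) :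
  (forall t, continuous f t) -> forall t, continuous (fun t => f (t + s)) t.
Proof.
  intros H t; apply (continuous_comp (fun t => t + s) f); [|apply H].
  apply: continuous_plus; [apply continuous_id | apply continuous_const].
Qed.

Lemma RInt_sum (F : nat -> R -> R) (a b : R) (n : nat) :
  (forall j t, continuous (F j) t) ->
  RInt (fun t => sum_f_R0 (fun j => F j t) n) a b = sum_f_R0 (fun j => RInt (F j) a b) n.
Proof.
  intros H.
  assert (C : forall n t, continuous (fun t => sum_f_R0 (fun j => F j t) n) t).
  { clear n; intros n; induction n as [|n IH]; intros t; simpl; [apply H|].
    apply: continuous_plus; [apply IH | apply H]. }
  induction n as [|n IH]; simpl; [reflexivity|].
  rewrite <- IH.
  replace (_ + _) with (1 * RInt (fun t => sum_f_R0 (fun j => F j t) n) a b + 1 * RInt (F (S n)) a b) by ring.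
  rewrite <- RInt_lin2 by (apply ex_RInt_cont; auto).
  apply RInt_eq; intros t; ring.
Qed.

(* Shifting by multiples of [d] replaces [q] by its average over the orbit. *)
Lemma RInt_orthogonal_periodic (n : nat) (q w : R -> R) :
  let d := 2 * PI / INR (S n) in
  (forall t, continuous q t) -> (forall t, continuous w t) ->
  (forall t, q (t + 2 * PI) = q t) -> (forall t, w (t + d) = w t) ->
  (forall t, sum_f_R0 (fun j => q (t + INR j * d)) n = 0) ->
  RInt (fun t => q t * w t) 0 (2 * PI) = 0.
Proof.
  intros d cq cw Hq Hw Hsum.
  assert (Hk : 0 < INR (S n)) by (apply lt_0_INR; lia).
  assert (Hkd : 2 * PI = INR (S n) * d) by (unfold d; field; lra).
  pose proof (periodic_iter w d Hw) as Hwj.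
  assert (Hj : forall j, RInt (fun t => q (t + INR j * d) * w t) 0 (2 * PI)
                         = RInt (fun t => q t * w t) 0 (2 * PI)).
  { intros j; rewrite <- (RInt_periodic (fun t => q t * w t) (2 * PI) (INR j * d)).
    - apply RInt_eq; intros t; rewrite (Rplus_comm (INR j * d)), Hwj; reflexivity.
    - now apply continuous_mult_fun.
    - intros t; rewrite Hq; f_equal; rewrite Hkd; apply Hwj. }
  apply (Rmult_eq_reg_r (INR (S n))); [|lra].
  rewrite <- sum_cte, Rmult_0_l.
  rewrite (sum_eq _ (fun j => RInt (fun t => q (t + INR j * d) * w t) 0 (2 * PI)))
    by (intros; now rewrite Hj).
  rewrite <- (RInt_sum (fun j t => q (t + INR j * d) * w t)).
  - rewrite (RInt_eq _ (fun t => 0)).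
    + rewrite RInt_const; unfold scal; simpl; unfold mult; simpl; ring.
    + intros t.
      rewrite <- scal_sum, Hsum; ring.
  - intros j; apply continuous_mult_fun; [|exact cw]; now apply continuous_shift.
Qed.

Lemma sum_cos_orbit (n : nat) (t : R) :
  (1 <= n)%nat -> sum_f_R0 (fun j => cos (t + INR j * (2 * PI / INR (S n)))) n = 0.
Proof.
  intros Hn; rewrite <- (sum_cos_roots n 1 t) by lia; apply sum_eq; intros j _.
  f_equal; simpl (INR 1); ring.
Qed.

Lemma sum_sin_orbit (n : nat) (t : R) :
  (1 <= n)%nat -> sum_f_R0 (fun j => sin (t + INR j * (2 * PI / INR (S n)))) n = 0.
Proof.
  intros Hn; rewrite <- (sum_cos_orbit n (t - PI / 2) Hn); apply sum_eq; intros j _.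
  rewrite <- cos_shift, <- cos_neg; f_equal; ring.
Qed.

(** * First harmonics, and the energy of periodic functions *)

Lemma is_C1_first_harmonics (c a b : R) :
  is_C1 (fun t => c + a * cos t + b * sin t) (fun t => - a * sin t + b * cos t).
Proof.
  split; intros t.
  - auto_derive; [easy | ring].
  - apply (ex_derive_continuous (K := R_AbsRing) (V := R_NormedModule)); auto_derive; easy.
Qed.

(** For this [g], [g'' + g] is the constant [c], and the boundary terms cancel because the end
    values of [f] agree. *)
Lemma bform_first_harmonics (c a b : R) (f f' : R -> R) :
  is_C1 f f' -> f (2 * PI) = f 0 ->
  bform 0 (2 * PI) f f' (fun t => c + a * cos t + b * sin t) (fun t => - a * sin t + b * cos t)
  = - c * RInt f 0 (2 * PI).
Proof.
  intros Hf Hper.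
  assert (Hl' : is_C1 (fun t => - a * sin t + b * cos t) (fun t => - a * cos t - b * sin t)).
  { split; intros t.
    - auto_derive; [easy | ring].
    - apply (ex_derive_continuous (K := R_AbsRing) (V := R_NormedModule)); auto_derive; easy. }
  rewrite (bform_by_parts _ _ _ _ _ _ _ Hf (is_C1_first_harmonics c a b) Hl').
  assert (ef : ex_RInt f 0 (2 * PI)).
  { apply ex_RInt_cont; intros t; now apply (is_C1_continuous f f'). }
  rewrite (RInt_eq _ (fun t => c * f t + 0 * f t)) by (intros; ring).
  rewrite RInt_lin2, Hper, sin_2PI, cos_2PI, sin_0, cos_0 by easy; ring.
Qed.

Lemma RInt_first_harmonics_mult (c a b : R) :
  RInt (fun t => c + a * cos t + b * sin t) 0 (2 * PI) = 2 * PI * c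
  /\ RInt (fun t => (c + a * cos t + b * sin t) * cos t) 0 (2 * PI) = PI * a
  /\ RInt (fun t => (c + a * cos t + b * sin t) * sin t) 0 (2 * PI) = PI * b.
Proof.
  repeat split.
  - rewrite (RInt_of_derive (fun t => c * t + a * sin t - b * cos t)).
    + rewrite sin_2PI, cos_2PI, sin_0, cos_0.
      eq_in_R; ring.
    + split; intros t; [auto_derive; [easy | ring]|].
      apply (ex_derive_continuous (K := R_AbsRing) (V := R_NormedModule)); auto_derive; easy.
  - rewrite (RInt_of_derive (fun t => c * sin t + a * (t + sin t * cos t) / 2 + b * (sin t * sin t) / 2)).
    + rewrite sin_2PI, cos_2PI, sin_0.
      eq_in_R; field.
    + split; intros t.
      * auto_derive; [easy|].
        pose proof (sin2_cos2 t) as E; unfold Rsqr in E.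
        replace (sin t * (1 * - sin t)) with (cos t * cos t - 1) by lra; field.
      * apply (ex_derive_continuous (K := R_AbsRing) (V := R_NormedModule)); auto_derive; easy.
  - rewrite (RInt_of_derive (fun t => - c * cos t + a * (sin t * sin t) / 2 + b * (t - sin t * cos t) / 2)).
    + rewrite sin_2PI, cos_2PI, sin_0, cos_0.
      eq_in_R; field.
    + split; intros t.
      * auto_derive; [easy|].
        pose proof (sin2_cos2 t) as E; unfold Rsqr in E.
        replace (sin t * (1 * - sin t)) with (- (sin t * sin t)) by ring.
        replace (1 * cos t * cos t) with (1 - sin t * sin t) by lra; field.
      * apply (ex_derive_continuous (K := R_AbsRing) (V := R_NormedModule)); auto_derive; easy.
Qed.

(* A [d]-periodic function minus its value at [0] vanishes at all the nodes. *)
Lemma bform_periodic_nonneg (n : nat) (g g' : R -> R) :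
  (2 <= n)%nat -> is_C1 g g' -> (forall t, g (t + 2 * PI / INR (S n)) = g t) ->
  RInt g 0 (2 * PI) = 0 -> 0 <= bform 0 (2 * PI) g g' g g'.
Proof.
  intros Hn Hg Hper Hint; pose proof PI_RGT_0 as HP.
  pose proof (periodic_iter g _ Hper) as Hj.
  assert (H2 : g (2 * PI) = g 0).
  { rewrite <- (Hj (S n) 0); f_equal; field; apply not_0_INR; lia. }
  pose proof (is_C1_lin2 1 (- g 0) _ _ _ _ Hg (is_C1_first_harmonics 1 0 0)) as Hw.
  pose proof (circle_lower_bound n _ _ Hn Hw) as B; cbv zeta beta in B.
  rewrite bform_square_lin2, !bform_first_harmonics, Hint in B
    by first [easy | apply is_C1_first_harmonics | rewrite ?cos_2PI, ?sin_2PI, ?cos_0, ?sin_0; ring].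
  rewrite (proj1 (RInt_first_harmonics_mult 1 0 0)) in B.
  rewrite (sum_eq _ (fun _ => 0)), sum_cte in B.
  - specialize (B ltac:(rewrite H2; ring)).
    replace (- 2 * _ * (0 * INR (S n)) ^ 2 / INR (S n)) with 0 in B by (unfold Rdiv; ring).
    (* What remains of [B] is that the energy of [g] is at least [2 * PI * g 0 ^ 2]. *)
    pose proof (pow2_ge_0 (g 0)); nra.
  - intros j _; rewrite <- (Rplus_0_l (INR j * _)), Hj; ring.
Qed.

(** * Length and area of an oval from its support function *)

Lemma oval_support_C2 (h : R -> R) :
  is_oval_support h -> is_C1 h (Derive h) /\ is_C1 (Derive h) (Derive_n h 2).
Proof.
  intros [_ [Hs _]].
  assert (C : forall m t, is_derive (Derive_n h m) t (Derive_n h (S m) t)).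
  { intros m t; apply Derive_correct, (Hs (S m) t). }
  assert (cC : forall m t, continuous (Derive_n h m) t).
  { intros m t; apply (ex_derive_continuous (K := R_AbsRing) (V := R_NormedModule)); eexists; apply C. }
  split; split; intros t.
  - apply (C O).
  - apply (cC 1%nat).
  - apply (C 1%nat).
  - apply (cC 2%nat).
Qed.

Lemma Derive_oval_x (h : R -> R) (t : R) :
  is_oval_support h -> Derive (oval_x h) t = - (h t + Derive_n h 2 t) * sin t.
Proof.
  intros [[D _] [D' _]]%oval_support_C2; apply is_derive_unique; unfold oval_x.
  evar_last.
  { apply: is_derive_minus; apply: is_derive_mult;
      [apply D | apply is_derive_cos | intros; apply Rmult_comm
      | apply D' | apply is_derive_sin | intros; apply Rmult_comm]. }
  unfold minus, plus, opp; simpl; unfold mult; simpl; ring.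
Qed.

Lemma Derive_oval_y (h : R -> R) (t : R) :
  is_oval_support h -> Derive (oval_y h) t = (h t + Derive_n h 2 t) * cos t.
Proof.
  intros [[D _] [D' _]]%oval_support_C2; apply is_derive_unique; unfold oval_y.
  evar_last.
  { apply: is_derive_plus; apply: is_derive_mult;
      [apply D | apply is_derive_sin | intros; apply Rmult_comm
      | apply D' | apply is_derive_cos | intros; apply Rmult_comm]. }
  unfold plus; simpl; unfold mult; simpl; ring.
Qed.

Lemma periodic_2PI_end (f : R -> R) : (forall t, f (t + 2 * PI) = f t) -> f (2 * PI) = f 0.
Proof. intros H; rewrite <- (H 0); f_equal; ring. Qed.

(** Cauchy's formula: the speed is the positive radius of curvature [h + h''], and [h''] integrates
    to zero over a period. *)
Lemma oval_length_eq (h : R -> R) :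
  is_oval_support h -> oval_length h = RInt h 0 (2 * PI).
Proof.
  intros Hh; destruct (oval_support_C2 h Hh) as [Hh1 Hh2]; unfold oval_length.
  rewrite (RInt_eq _ (fun t => 1 * h t + 1 * Derive_n h 2 t)).
  - rewrite RInt_lin2, (RInt_of_derive _ _ _ _ Hh2).
    + rewrite (periodic_2PI_end _ (periodic_derive _ _ _ Hh1 (proj1 Hh))); ring.
    + apply ex_RInt_cont; intros t; now apply (is_C1_continuous _ (Derive h)).
    + apply ex_RInt_cont; apply Hh2.
  - intros t; rewrite Derive_oval_x, Derive_oval_y by easy.
    pose proof (proj2 (proj2 Hh) t) as Hpos.
    pose proof (sin2_cos2 t) as E; unfold Rsqr in E.
    set (rho := h t + Derive_n h 2 t) in *.
    replace ((- rho * sin t) ^ 2 + (rho * cos t) ^ 2)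
      with (rho ^ 2 * (sin t * sin t + cos t * cos t)) by ring.
    rewrite E, Rmult_1_r, sqrt_pow2 by lra; unfold rho; ring.
Qed.

(** Green's integrand equals [h * (h + h'')]; integrating by parts gives the energy form. *)
Lemma oval_area_eq (h : R -> R) :
  is_oval_support h ->
  oval_area h = - / 2 * bform 0 (2 * PI) h (Derive h) h (Derive h).
Proof.
  intros Hh; destruct (oval_support_C2 h Hh) as [Hh1 Hh2]; unfold oval_area.
  rewrite (bform_by_parts _ _ _ _ _ _ _ Hh1 Hh1 Hh2).
  rewrite (periodic_2PI_end h (proj1 Hh)), (periodic_2PI_end _ (periodic_derive _ _ _ Hh1 (proj1 Hh))).
  rewrite (RInt_eq _ (fun t => h t * (Derive_n h 2 t + h t))); [ring|].
  intros t; rewrite Derive_oval_x, Derive_oval_y by easy; unfold oval_x, oval_y.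
  pose proof (sin2_cos2 t) as E; unfold Rsqr in E.
  transitivity (h t * (Derive_n h 2 t + h t) * (sin t * sin t + cos t * cos t)); [ring|].
  rewrite E; ring.
Qed.

(** * The order preserving set and the splitting of the support function *)

Definition hk' (h : R -> R) (k : nat) (s : R) : R :=
  / INR k * sum_f_R0 (fun j => Derive h (s + 2 * PI * INR j / INR k)) (k - 1).

Lemma is_C1_hk (h : R -> R) (k : nat) : is_oval_support h -> is_C1 (hk h k) (hk' h k).
Proof.
  intros Hh; destruct (oval_support_C2 h Hh) as [Hh1 _].
  assert (Hsum := is_C1_sum (fun j t => h (2 * PI * INR j / INR k + t))
    (fun j t => Derive h (2 * PI * INR j / INR k + t)) (k - 1)
    (fun j => is_C1_shift _ _ _ Hh1)).
  eapply is_C1_ext; [| |exact (is_C1_lin2 (/ INR k) (- / 2 * avg_width h) _ _ _ _ Hsum (is_C1_const 1))];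
    intros t; unfold hk, hk'; simpl.
  - rewrite (sum_eq _ (fun j => h (t + 2 * PI * INR j / INR k))); [ring|].
    intros; now rewrite Rplus_comm.
  - rewrite (sum_eq _ (fun j => Derive h (t + 2 * PI * INR j / INR k))); [ring|].
    intros; now rewrite Rplus_comm.
Qed.

Lemma avg_width_a0 (h : R -> R) : avg_width h = 2 * a0 h.
Proof. unfold avg_width, a0; field; apply PI_neq0. Qed.

Lemma sum_orbit_hk (h : R -> R) (n : nat) (t : R) :
  sum_f_R0 (fun j => h (t + INR j * (2 * PI / INR (S n)))) n = INR (S n) * (hk h (S n) t + a0 h).
Proof.
  assert (Hk : 0 < INR (S n)) by (apply lt_0_INR; lia).
  unfold hk; rewrite avg_width_a0; replace (S n - 1)%nat with n by lia.
  rewrite (sum_eq _ (fun j => h (t + 2 * PI * INR j / INR (S n)))).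
  - field; lra.
  - intros j _; do 2 f_equal; field; lra.
Qed.

(** Rotation by [d] permutes the points of an orbit cyclically. *)
Lemma hk_periodic (h : R -> R) (n : nat) (t : R) :
  (forall s, h (s + 2 * PI) = h s) -> hk h (S n) (t + 2 * PI / INR (S n)) = hk h (S n) t.
Proof.
  intros Hper; set (d := 2 * PI / INR (S n)).
  assert (Hk : 0 < INR (S n)) by (apply lt_0_INR; lia).
  apply (Rplus_eq_reg_r (a0 h)), (Rmult_eq_reg_l (INR (S n))); [|lra].
  rewrite <- !sum_orbit_hk; fold d.
  rewrite <- (sum_cyclic n (fun j => h (t + INR j * d))).
  - apply sum_eq; intros j _; f_equal; rewrite S_INR; ring.
  - simpl (INR 0); rewrite Rmult_0_l, Rplus_0_r, <- (Hper t).
    f_equal; unfold d; field; lra.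
Qed.

Lemma RInt_1_harmonics (h : R -> R) :
  RInt h 0 (2 * PI) = 2 * PI * a0 h
  /\ RInt (fun t => h t * cos t) 0 (2 * PI) = PI * a1 h
  /\ RInt (fun t => h t * sin t) 0 (2 * PI) = PI * b1 h.
Proof.
  pose proof PI_neq0.
  assert (E : forall c x : R, c <> 0 -> x = c * (/ c * x)) by (intros; field; easy).
  repeat split; apply E; lra.
Qed.

Lemma RInt_minus_R (f g : R -> R) (a b : R) :
  (forall t, continuous f t) -> (forall t, continuous g t) ->
  RInt (fun t => f t - g t) a b = RInt f a b - RInt g a b.
Proof.
  intros Hf Hg; rewrite (RInt_eq _ (fun t => 1 * f t + -1 * g t)) by (intros; ring).
  rewrite RInt_lin2 by now apply ex_RInt_cont.
  eq_in_R; ring.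
Qed.

Lemma d_infty_sqr_le (h1 h2 : R -> R) (M : R) :
  (forall s, (h1 s - h2 s) ^ 2 <= M) -> d_infty h1 h2 ^ 2 <= M.
Proof.
  intros HM.
  assert (M0 : 0 <= M) by (refine (Rle_trans _ _ _ _ (HM 0)); apply pow2_ge_0).
  unfold d_infty; set (E := fun x => exists s, x = Rabs (h1 s - h2 s)).
  destruct (Lub_Rbar_correct E) as [Hub Hleast].
  assert (Hle : Rbar_le (Lub_Rbar E) (sqrt M)).
  { apply Hleast; intros x [s ->]; simpl.
    rewrite <- (sqrt_pow2 (Rabs (h1 s - h2 s))) by apply Rabs_pos.
    apply sqrt_le_1_alt; rewrite pow2_abs; apply HM. }
  (* [real] sends infinite values to [0], so finiteness must be shown. This lower bound excludes
     minus infinity and gives the sign needed for squaring. *)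
  assert (Hge : Rbar_le (Rabs (h1 0 - h2 0)) (Lub_Rbar E)) by (apply Hub; now exists 0).
  pose proof (Rabs_pos (h1 0 - h2 0)) as Hp.
  destruct (Lub_Rbar E) as [r| |]; simpl in *; [|easy|easy].
  rewrite <- (pow2_sqrt M) by easy.
  apply (pow_incr r (sqrt M) 2); lra.
Qed.

(** Pythagoras for [bform]: with [l] the support function of the Steiner disk and [g] that of the
    order preserving set, [v = h - l] splits into the orthogonal pieces [f] and [g]. The
    isoperimetric deficit is [2 * PI] times the energy of [v], and [4 * PI * Rabs (area_Pk h (S n))]
    is [2 * PI] times that of [g]. *)
Lemma oval_harmonic_splitting (h : R -> R) (n : nat) :
  (2 <= n)%nat -> is_oval_support h ->
  let f := fun t => h t - h_Pk_plus_D h (S n) t in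
  exists f', is_C1 f f' /\ (forall t, f (t + 2 * PI) = f t)
  /\ RInt (fun t => f t * cos t) 0 (2 * PI) = 0
  /\ RInt (fun t => f t * sin t) 0 (2 * PI) = 0
  /\ (forall t, sum_f_R0 (fun j => f (t + INR j * (2 * PI / INR (S n)))) n = 0)
  /\ oval_length h ^ 2 - 4 * PI * oval_area h - 4 * PI * Rabs (area_Pk h (S n))
     = 2 * PI * bform 0 (2 * PI) f f' f f'.
Proof.
  intros Hn Hh f; pose proof PI_RGT_0 as HP.
  set (d := 2 * PI / INR (S n)).
  assert (Hk : 0 < INR (S n)) by (apply lt_0_INR; lia).
  destruct (oval_support_C2 h Hh) as [Hh1 Hh2].
  pose proof (proj1 Hh) as hper.
  set (g := hk h (S n)); set (g' := hk' h (S n)).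
  assert (Hg : is_C1 g g') by now apply is_C1_hk.
  assert (gd : forall t, g (t + d) = g t) by (intros; now apply hk_periodic).
  pose proof (periodic_iter g d gd) as gj.
  assert (Hkd : 2 * PI = INR (S n) * d) by (unfold d; field; lra).
  assert (gper : forall t, g (t + 2 * PI) = g t) by (intros; rewrite Hkd; apply gj).
  set (l := fun t => a0 h + a1 h * cos t + b1 h * sin t).
  set (l' := fun t => - a1 h * sin t + b1 h * cos t).
  assert (Hl : is_C1 l l') by apply is_C1_first_harmonics.
  assert (lper : forall t, l (t + 2 * PI) = l t).
  { intros t; unfold l; rewrite cos_plus, sin_plus, cos_2PI, sin_2PI; ring. }
  set (v := fun t => 1 * h t + -1 * l t); set (v' := fun t => 1 * Derive h t + -1 * l' t).
  assert (Hv : is_C1 v v') by now apply is_C1_lin2.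
  set (f1 := fun t => 1 * v t + -1 * g t); set (f' := fun t => 1 * v' t + -1 * g' t).
  assert (Hf1 : is_C1 f1 f') by now apply is_C1_lin2.
  assert (Ef : forall t, f t = f1 t) by (intros; unfold f, f1, v, l, g, h_Pk_plus_D; ring).
  assert (Hf : is_C1 f f') by (apply (is_C1_ext f1 f f' f'); auto).
  assert (fper : forall t, f (t + 2 * PI) = f t).
  { intros t; rewrite !Ef; unfold f1, v; rewrite hper, lper, gper; ring. }
  assert (fsum : forall t, sum_f_R0 (fun j => f (t + INR j * d)) n = 0).
  { intros t.
    rewrite (sum_eq _ (fun j => 1 * h (t + INR j * d) + -1 * (1 * (1 * (g t + a0 h)) +
      1 * (a1 h * cos (t + INR j * d) + b1 h * sin (t + INR j * d))))).
    - rewrite !sum_lin2.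
      rewrite (sum_eq (fun _ => 1 * (g t + a0 h)) (fun _ => g t + a0 h)), sum_cte by (intros; ring).
      unfold d at 1; rewrite sum_orbit_hk; unfold d; rewrite sum_cos_orbit, sum_sin_orbit by lia.
      fold g; ring.
    - intros j _; rewrite Ef; unfold f1, v, l; rewrite gj; ring. }
  assert (f'sum : forall t, sum_f_R0 (fun j => f' (t + INR j * d)) n = 0).
  { apply (is_C1_unique (fun _ => 0)); [|apply is_C1_const].
    eapply is_C1_ext; [| |apply (is_C1_sum (fun j t => f (INR j * d + t))
      (fun j t => f' (INR j * d + t)) n (fun j => is_C1_shift _ _ _ Hf))]; intros t; simpl.
    - rewrite <- (fsum t); apply sum_eq; intros; now rewrite Rplus_comm.
    - apply sum_eq; intros; now rewrite Rplus_comm. }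
  pose proof (fun t => is_C1_continuous _ _ t Hf) as cf.
  pose proof (fun t => is_C1_continuous _ _ t Hg) as cg.
  pose proof (fun t => is_C1_continuous _ _ t Hl) as cl.
  pose proof (fun t => is_C1_continuous _ _ t Hh1) as ch.
  destruct (RInt_1_harmonics h) as [I0 [I1 I2]].
  destruct (RInt_first_harmonics_mult (a0 h) (a1 h) (b1 h)) as [L0 [L1 L2]].
  assert (Ffun : forall t, f t = h t - (g t + l t)).
  { intros t; rewrite Ef; unfold f1, v; ring. }
  assert (fint : RInt f 0 (2 * PI) = 0).
  { rewrite (RInt_eq _ (fun t => f t * 1)) by (intros; ring).
    apply (RInt_orthogonal_periodic n f (fun _ => 1)); auto.
    intros; apply continuous_const. }
  assert (gint : RInt g 0 (2 * PI) = 0).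
  { rewrite (RInt_eq _ (fun t => h t - f t - l t)) by (intros; rewrite Ffun; ring).
    rewrite !RInt_minus_R, fint, I0; auto.
    - unfold l; rewrite L0; eq_in_R; ring.
    - intros t; apply: continuous_minus; auto. }
  (* Here [cos] has vanishing orbit sums and [g] is the [d]-periodic weight. *)
  assert (gcos : RInt (fun t => cos t * g t) 0 (2 * PI) = 0).
  { apply (RInt_orthogonal_periodic n cos g); auto.
    - intros; apply continuous_cos.
    - intros t; rewrite cos_plus, cos_2PI, sin_2PI; ring.
    - intros t; apply sum_cos_orbit; lia. }
  assert (gsin : RInt (fun t => sin t * g t) 0 (2 * PI) = 0).
  { apply (RInt_orthogonal_periodic n sin g); auto.
    - intros; apply continuous_sin.
    - intros t; rewrite sin_plus, cos_2PI, sin_2PI; ring.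
    - intros t; apply sum_sin_orbit; lia. }
  exists f'; repeat split; try apply Hf; auto.
  - rewrite (RInt_eq _ (fun t => h t * cos t - l t * cos t - cos t * g t)) by (intros; rewrite Ffun; ring).
    rewrite !RInt_minus_R, gcos, I1; unfold l;
      auto using continuous_mult_fun, continuous_minus_fun, continuous_cos.
    rewrite L1; eq_in_R; ring.
  - rewrite (RInt_eq _ (fun t => h t * sin t - l t * sin t - sin t * g t)) by (intros; rewrite Ffun; ring).
    rewrite !RInt_minus_R, gsin, I2; unfold l;
      auto using continuous_mult_fun, continuous_minus_fun, continuous_sin.
    rewrite L2; eq_in_R; ring.
  (* Both products in the form pair a function with zero orbit sums and a [d]-periodic one. *)
  - assert (Bfg : bform 0 (2 * PI) f1 f' g g' = 0).
    { unfold bform; rewrite RInt_minus_R.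
      - rewrite (RInt_orthogonal_periodic n f' g'), (RInt_orthogonal_periodic n f1 g).
        + ring.
        + intros t; apply (is_C1_continuous f1 f' t Hf1).
        + exact cg.
        + intros t; rewrite <- !Ef; apply fper.
        + exact gd.
        + intros t; rewrite <- (fsum t); apply sum_eq; intros; now rewrite Ef.
        + apply Hf.
        + apply Hg.
        + now apply (periodic_derive f f').
        + now apply (periodic_derive g g').
        + exact f'sum.
      - apply continuous_mult_fun; [apply Hf | apply Hg].
      - apply continuous_mult_fun; [intros t; apply (is_C1_continuous f1 f' t Hf1) | exact cg]. }
    replace (bform 0 (2 * PI) f f' f f') with (bform 0 (2 * PI) f1 f' f1 f')
      by (apply RInt_eq; intros; now rewrite Ef).
    pose proof (bform_periodic_nonneg n g g' Hn Hg gd gint) as Hgpos.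
    assert (Earea : area_Pk h (S n) = - / 2 * bform 0 (2 * PI) g g' g g').
    { unfold area_Pk, bform; rewrite (RInt_eq _ (fun t => -1 * (g' t * g' t - g t * g t) + 0 * 0)).
      - rewrite (RInt_lin2 (-1) 0 _ _ _ (fun _ => 0)); [ring | now apply ex_RInt_bform |].
        apply ex_RInt_cont; intros; apply continuous_const.
      - intros t; fold g; rewrite (is_derive_unique _ _ _ (proj1 Hg t)); ring. }
    rewrite Earea, Ropp_mult_distr_l_reverse, Rabs_Ropp, Rabs_pos_eq by lra.
    rewrite oval_length_eq, oval_area_eq, I0 by easy.
    assert (Bv : bform 0 (2 * PI) v v' g g' = bform 0 (2 * PI) g g' g g').
    { unfold f1, f' in Bfg; rewrite bform_lin2 in Bfg by easy; lra. }
    assert (Qf : bform 0 (2 * PI) f1 f' f1 f'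
                 = bform 0 (2 * PI) v v' v v' - bform 0 (2 * PI) g g' g g').
    { unfold f1, f'; rewrite bform_square_lin2, Bv by easy; ring. }
    assert (Qv : bform 0 (2 * PI) v v' v v'
                 = bform 0 (2 * PI) h (Derive h) h (Derive h) + 2 * PI * a0 h ^ 2).
    { unfold v, v'; rewrite bform_square_lin2 by easy.
      unfold l at 1 3, l' at 1 3.
      rewrite !bform_first_harmonics by (easy || now apply periodic_2PI_end).
      rewrite I0; unfold l; rewrite L0; eq_in_R; ring. }
    rewrite Qf, Qv; field.
Qed.

Theorem theorem5p6 (k : nat) (h : R -> R) :
  (2 < k)%nat ->
  is_oval_support h ->
  oval_length h ^ 2 - 4 * PI * oval_area h - 4 * PI * Rabs (area_Pk h k)
  >= 8 * PI ^ 2 * INR k / (2 * PI * (cos (PI / INR k) / sin (PI / INR k)) + INR k)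
     * d_infty h (h_Pk_plus_D h k) ^ 2.
Proof.
  intros Hk Hh; destruct k as [|n]; [lia|]; pose proof PI_RGT_0 as HP.
  destruct (oval_harmonic_splitting h n ltac:(lia) Hh) as [f' [Hf [fper [fcos [fsin [fsum ->]]]]]].
  set (f := fun t => h t - h_Pk_plus_D h (S n) t) in *.
  set (Q := bform 0 (2 * PI) f f' f f').
  assert (Hk3 : 3 <= INR (S n)) by (replace 3 with (INR 3) by (simpl; ring); apply le_INR; lia).
  assert (Hh2 : 0 < PI / INR (S n) < PI / 2).
  { split; [apply Rdiv_lt_0_compat; lra|].
    apply Rmult_lt_compat_l; [easy|]; apply Rinv_lt_contravar; lra. }
  assert (Hs : 0 < sin (PI / INR (S n))) by (apply sin_gt_0; lra).
  assert (Hc : 0 < cos (PI / INR (S n))) by (apply cos_gt_0; lra).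
  set (ct := cos (PI / INR (S n)) / sin (PI / INR (S n))).
  assert (Hct : 0 < ct) by (now apply Rdiv_lt_0_compat).
  assert (HK : peak_constant (INR (S n)) = (2 * PI * ct + INR (S n)) / (4 * INR (S n))).
  { unfold peak_constant; fold ct; field; lra. }
  set (W := 2 * PI * ct + INR (S n)) in *.
  assert (HW : 0 < W) by (unfold W; nra).
  (* The pointwise bound has the same right side for every [s], so it passes to the supremum. *)
  assert (HD : d_infty h (h_Pk_plus_D h (S n)) ^ 2 <= peak_constant (INR (S n)) * Q / PI).
  { apply d_infty_sqr_le; intros s.
    apply (Rmult_le_reg_l PI); [easy|].
    replace (PI * (peak_constant (INR (S n)) * Q / PI)) with (peak_constant (INR (S n)) * Q) by (field; lra).
    apply (evaluation_bound n f f' s); auto; lia. }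
  rewrite HK in HD.
  apply Rle_ge.
  replace (2 * PI * Q) with (8 * PI ^ 2 * INR (S n) / W * (W / (4 * INR (S n)) * Q / PI)) by (field; lra).
  apply Rmult_le_compat_l; [|exact HD].
  apply Rlt_le, Rdiv_lt_0_compat; [nra | easy].
Qed.
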